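(* (Hydrostatic limit.) Let $\theta\ge1$, $\kappa>0$ and $\alpha,\lambda,\beta,\delta>0$. Then the sequence of invariant measures $\{\bar\nu_N\}_N$ is associated to the profile $\bar\rho_\theta$: for every $r>0$ and every continuous $H:[0,1]\to\mathbb R$, $$\lim_{N\to\infty}\bar\nu_N\left\{\eta\in\Omega_N:\left|\frac1N\sum_{x=1}^{N-1}H\left(\frac xN\right)\eta(x)-\int_0^1H(u)\bar\rho_\theta(u)\,du\right|>r\right\}=0,$$ where $\bar\rho_\theta(u)=R(\bar\varphi_\theta(u))$, with $$\bar\varphi_\theta(u)=\frac{-\kappa(\alpha\delta-\beta\lambda)u+\kappa\alpha\delta+\alpha+\beta}{\kappa\lambda\delta+\lambda+\delta}\ \text{ if }\theta=1,\qquad \bar\varphi_\theta(u)=\frac{\alpha+\beta}{\lambda+\delta}\ \text{ if }\theta>1.$$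
   Context: $\mathbb N=\{0,1,2,\dots\}$. $g:\mathbb N\to[0,\infty)$ satisfies $g(0)=0$, $g(k)>0$ for $k\ge1$, $\sup_{k\ge1}|g(k+1)-g(k)|<\infty$, and $g$ is non-decreasing. Put $g(k)!=\prod_{j=1}^kg(j)$, $g(0)!=1$, $Z(\varphi)=\sum_{k\ge0}\varphi^k/g(k)!$ with radius of convergence $\varphi^*$; assume $\lim_{\varphi\uparrow\varphi^*}Z(\varphi)=\infty$. $R(\varphi)=Z(\varphi)^{-1}\sum_{k\ge0}k\varphi^k/g(k)!$ on $[0,\varphi^* )$. $I_N=\{1,\dots,N-1\}$, $\Omega_N=\mathbb N^{I_N}$. $\bar\nu_N$ is the product measure on $\Omega_N$ with marginals $\bar\nu_N\{\eta(x)=k\}=\bar\varphi_N(x)^k/(Z(\bar\varphi_N(x))g(k)!)$, where $$\bar\varphi_N(x)=\frac{-\kappa(\alpha\delta-\beta\lambda)(x-1)+\kappa\alpha\delta(N-2)+(\alpha+\beta)N^\theta}{\kappa\lambda\delta(N-2)+(\lambda+\delta)N^\theta},$$ and it is assumed that $\sup_N\sup_{x\in I_N}\bar\varphi_N(x)<\varphi^*$. It is the invariant measure of the zero-range process on $I_N$ in which a particle at $x$ jumps to each neighbour in $I_N$ at rate $g(\eta(x))$, particles are created at sites $1$ and $N-1$ at rates $\kappa\alpha N^{-\theta}$ and $\kappa\beta N^{-\theta}$, and removed from these sites at rates $\kappa\lambda g(\eta(1))N^{-\theta}$ and $\kappa\delta g(\eta(N-1))N^{-\theta}$ respectively. (The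 profile $\bar\rho_\theta$ is a stationary solution of the hydrodynamic equation $\partial_t\rho=\Delta\Phi(\rho)$, $\Phi=R^{-1}$, with boundary conditions $\partial_u\Phi(\rho(0))=\tilde\kappa(\lambda\Phi(\rho(0))-\alpha)$, $\partial_u\Phi(\rho(1))=\tilde\kappa(\beta-\delta\Phi(\rho(1)))$, $\tilde\kappa=\kappa\mathbf 1_{\{\theta=1\}}$.) *)

(* Defs.v *)
From HB Require Import structures.
From mathcomp Require Export all_boot all_order all_algebra.
From mathcomp Require Export all_classical all_reals all_analysis.
Export Order.TTheory GRing.Theory Num.Theory.
Export numFieldNormedType.Exports.

Set Implicit Arguments.
Unset Strict Implicit.
Unset Printing Implicit Defensive.

Global Open Scope classical_set_scope.
Global Open Scope ring_scope.

Section partition_function.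
Context {R : realType}.
Implicit Types (g : nat -> R) (phi : R).

Definition gfact g (k : nat) : R := \prod_(1 <= j < k.+1) g j.

Definition Zcoef g (k : nat) : R := (gfact g k)^-1.

Definition Zfun g phi : R := limn (pseries (Zcoef g) phi).

(* Radius of convergence of Z; it may be +oo. *)
Definition phistar g : \bar R :=
  ereal_sup [set `|x|%:E | x in [set x : R | cvgn (pseries (Zcoef g) x)]].

(* The function R of the zero-range process: the mean occupation number at
   fugacity phi. It is only meaningful for 0 <= phi < phistar g. *)
Definition Rfun g phi : R :=
  (Zfun g phi)^-1 * limn (pseries (fun k => k%:R * Zcoef g k) phi).

(* Divergence of Z at phistar from the left. The left filter is taken in
   \bar R so as to cover both phistar < +oo and phistar = +oo. *)
Definition Z_diverges g : Prop :=
  Zfun g (fine y) @[y --> within [set y | (y < phistar g)%E] (nbhs (phistar g))]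
    --> +oo.

Definition occupation_pmf g phi (k : nat) : R :=
  phi ^+ k / (Zfun g phi * gfact g k).

End partition_function.

Section fugacity_profiles.
Context {R : realType}.
Variables (kappa alpha lambda beta delta theta : R).

Definition phibarN (N x : nat) : R :=
  (- kappa * (alpha * delta - beta * lambda) * (x%:R - 1)
   + kappa * alpha * delta * (N%:R - 2) + (alpha + beta) * N%:R `^ theta)
  / (kappa * lambda * delta * (N%:R - 2) + (lambda + delta) * N%:R `^ theta).

(* Meant for theta >= 1: the else branch is the case theta > 1. *)
Definition phibar (u : R) : R :=
  if theta == 1 then
    (- kappa * (alpha * delta - beta * lambda) * u
     + kappa * alpha * delta + alpha + beta)
    / (kappa * lambda * delta + lambda + delta)
  else (alpha + beta) / (lambda + delta).

Definition rhobar (g : nat -> R) (u : R) : R := Rfun g (phibar u).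

End fugacity_profiles.

(* The configuration space over the sites {1, ..., N-1}. Tuples are indexed from
   0, so that component i is the occupation number of the site i.+1. *)
Notation config N := ((N.-1).-tuple nat).

Section configurations.
Context {R : realType}.

(* The coordinates are independent: P is the product of its marginals. *)
Definition is_product_measure (N : nat) (P : probability (config N) R) : Prop :=
  forall A : 'I_N.-1 -> set nat,
    P [set eta | forall i, A i (tnth eta i)] =
    (\prod_(i < N.-1) P [set eta | A i (tnth eta i)])%E.

Definition has_marginals (N : nat) (P : probability (config N) R)
    (p : nat -> nat -> R) : Prop :=
  forall (i : 'I_N.-1) (k : nat),
    P [set eta | tnth eta i = k] = (p i.+1 k)%:E.

(* The integral of H against the empirical measure of eta. *)
Definition empirical (N : nat) (H : R -> R) (eta : config N) : R :=
  N%:R^-1 * \sum_(i < N.-1) H (i.+1%:R / N%:R) * (tnth eta i)%:R.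

Definition associated_to_profile (P : forall N, probability (config N) R)
    (rho : R -> R) : Prop :=
  forall r : R, 0 < r ->
  forall H : R -> R, {within `[0, 1], continuous H} ->
    P N [set eta | r < `| empirical H eta -
                  \int[lebesgue_measure]_(u in `[0, 1]) (H u * rho u) |]
      @[N --> \oo] --> 0%E.

End configurations.

(* Main.v *)
Require Import Defs.
From mathcomp Require Import measurable_realfun lra ring.

Set Implicit Arguments.
Unset Strict Implicit.
Unset Printing Implicit Defensive.

(** The theorem is a weak law of large numbers combined with a Riemann sum.

    Under the invariant measure the occupation numbers are independent, with
    means Rfun (phibarN N x). All the fugacities phibarN N x lie in an interval
    [0, c] that is strictly inside the disc of convergence of Z
    (subcritical_bound), so the second moments of the occupation numbers are
    bounded uniformly in N and x (occupation_second_moment). By Chebyshev's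
    inequality the empirical average then deviates from its mean by more than
    r / 2 with probability O(1/N) (product_measure_weak_law).

    It remains to find the limit of the mean
    N^-1 \sum_x H (x / N) Rfun (phibarN N x), see mean_density_near. Power series
    are smooth inside their disc of convergence, so Rfun is uniformly continuous
    on [0, c]; since phibarN N x is close to phibar (x / N) uniformly in the site
    (phibarN_near_phibar), the mean is asymptotically the Riemann sum of
    H * rhobar, which converges to the integral (riemann_sum_cvg). *)

(** * Power series inside the disc of convergence *)

Section power_series.
Context {R : realType}.
Implicit Types (f : nat -> R) (x y : R).

(** What makes termwise differentiation harmless strictly inside the disc of
    convergence: the factor k.+1 is absorbed by passing from the radius y to a
    larger radius z. *)
Lemma geometric_gap (y z : R) k : 0 <= y -> y <= z ->
  k.+1%:R * (z - y) * y ^+ k <= z ^+ k.+1.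
Proof.
move=> y0 yz; have z0 := le_trans y0 yz.
(* The difference of powers is what the induction propagates. *)
suff : k.+1%:R * (z - y) * y ^+ k <= z ^+ k.+1 - y ^+ k.+1.
  by move=> /le_trans; apply; rewrite lerBlDr lerDl exprn_ge0.
elim: k => [|k IH]; first by rewrite expr0 !expr1; lra.
have hz : y ^+ k.+1 * (z - y) <= z ^+ k.+1 * (z - y).
  by rewrite ler_wpM2r ?subr_ge0// lerXn2r.
have := ler_wpM2l y0 IH.
rewrite -[k.+2%:R]natr1 !(exprS _ k.+1) exprS in hz *.
move: hz; set s := z ^+ k.+1; set t := y ^+ k; set K := k.+1%:R; nra.
Qed.

Lemma is_cvg_series_shiftS (u : nat -> R) :
  cvgn (series (fun k => u k.+1)) <-> cvgn (series u).
Proof.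
have uE : [sequence series u n.+1]_n = (fun n => u 0%N + series (fun k => u k.+1) n).
  by apply/funext => n; rewrite /series/= big_nat_recl.
split => [/cvg_ex[l ul]|/cvg_ex[l ul]]; apply/cvg_ex.
  exists (u 0%N + l); rewrite -cvg_shiftS uE.
  by apply: (cvgD (cvg_cst _) ul).
exists (l - u 0%N).
rewrite [X in X @ _](_ : _ = (fun n => series u n.+1 - u 0%N)); last first.
  by apply/funext => n; rewrite -[series u n.+1]/([sequence series u n.+1]_n n) uE addrC addKr.
by apply: cvgB; [rewrite -cvg_shiftS in ul|exact: cvg_cst].
Qed.

Lemma is_cvg_pseries_diffs f x y : cvgn (pseries f x) -> `|y| < `|x| ->
  cvgn (pseries (pseries_diffs f) y).
Proof.
move=> fx yx; pose z := (`|x| + `|y|) / 2.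
have [yz zx] : `|y| < z /\ z < `|x| by rewrite /z; split; lra.
have z0 : 0 < z by apply: le_lt_trans yz.
have fz : cvgn (pseries (fun i => `|f i|) z).
  by apply: is_cvg_pseries_inside_norm fx _; rewrite gtr0_norm.
apply: normed_cvg.
apply: (@series_le_cvg _ _ (fun k => (z - `|y|)^-1 * (`|f k.+1| * z ^+ k.+1))).
- by move=> k /=.
- move=> k; rewrite mulr_ge0 ?invr_ge0 ?subr_ge0 ?(ltW yz)//.
  by rewrite mulr_ge0// exprn_ge0// ltW.
- move=> k; rewrite /pseries_diffs /= !normrM normr_nat normrX.
  rewrite ler_pdivlMl ?subr_gt0//.
  have -> : (z - `|y|) * (k.+1%:R * `|f k.+1| * `|y| ^+ k) =
      `|f k.+1| * (k.+1%:R * (z - `|y|) * `|y| ^+ k) by ring.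
  by rewrite ler_wpM2l// geometric_gap// ltW.
- have := (is_cvg_series_shiftS (fun k => `|f k| * z ^+ k)).2 fz.
  exact: is_cvg_seriesZ.
Qed.

(** Up to a shift of index and a factor y, this is the derived series. It can be
    iterated, which gives all the moments of the occupation number. *)
Lemma is_cvg_pseries_natM f x y : cvgn (pseries f x) -> `|y| < `|x| ->
  cvgn (pseries (fun k => k%:R * f k) y).
Proof.
move=> fx yx; apply/is_cvg_series_shiftS.
rewrite [X in series X](_ : _ = y *: (fun k => pseries_diffs f k * y ^+ k)).
  by apply: is_cvg_seriesZ; exact: is_cvg_pseries_diffs fx yx.
apply/funext => k; rewrite -[RHS]/(y * (k.+1%:R * f k.+1 * y ^+ k)) /= exprS.
by ring.
Qed.

(** Differentiability at y needs the first two derived series at some radius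
    beyond y, so two radii are inserted between y and x. *)
Lemma pseries_continuous f x y : cvgn (pseries f x) -> `|y| < `|x| ->
  {for y, continuous (fun t => limn (pseries f t))}.
Proof.
move=> fx yx; pose w := (`|x| + `|y|) / 2; pose z := (w + `|y|) / 2.
have [yz zx] : `|y| < z /\ z < w by rewrite /z /w; split; lra.
have w0 : 0 <= w by rewrite /w; have := normr_ge0 x; have := normr_ge0 y; lra.
have z0 : 0 <= z by rewrite /z; have := normr_ge0 y; lra.
have wx : `|w| < `|x| by rewrite ger0_norm// /w; lra.
have zw : `|z| < `|w| by rewrite !ger0_norm.
have fw := is_cvg_pseries_diffs fx wx.
have := @pseries_snd_diffs _ f z y.
move=> /(_ (is_cvg_pseries_inside fx (lt_trans zw wx))).
move=> /(_ (is_cvg_pseries_inside fw zw)).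
move=> /(_ (is_cvg_pseries_diffs fw zw)).
rewrite (ger0_norm z0) => /(_ yz) d.
by apply/differentiable_continuous/derivable1_diffP; case: d.
Qed.

End power_series.

Lemma eseries_EFin {R : realType} (u : nat -> R) : cvgn (series u) ->
  (\sum_(k <oo) (u k)%:E = (limn (series u))%:E)%E.
Proof.
move=> cu; rewrite -EFin_lim//; congr (limn _); apply/funext => n.
by rewrite /series/= sumEFin.
Qed.

(** * The occupation law at a given fugacity *)

Section fugacity.
Context {R : realType} (g : nat -> R).
Hypothesis gpos : forall k, (1 <= k)%N -> 0 < g k.
Variable x0 : R.
Hypothesis Zx0 : cvgn (pseries (Zcoef g) x0).

Lemma gfact_gt0 k : 0 < gfact g k.
Proof.
rewrite /gfact big_nat_cond prodr_gt0// => j /andP[/andP[j1 _] _].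
exact: gpos.
Qed.

Lemma Zcoef_ge0 k : 0 <= Zcoef g k.
Proof. by rewrite invr_ge0 ltW// gfact_gt0. Qed.

Let inside phi : 0 <= phi -> phi < `|x0| -> `|phi| < `|x0|.
Proof. by move=> p0 px; rewrite ger0_norm. Qed.

Let is_cvg_natZ x : `|x| < `|x0| ->
  cvgn (pseries (fun k => k%:R * Zcoef g k) x).
Proof. exact: is_cvg_pseries_natM Zx0. Qed.

Let is_cvg_natnatZ x : `|x| < `|x0| ->
  cvgn (pseries (fun k => k%:R * (k%:R * Zcoef g k)) x).
Proof.
move=> xx0; pose z := (`|x| + `|x0|) / 2.
have z0 : 0 <= z by rewrite /z; have := normr_ge0 x; have := normr_ge0 x0; lra.
apply: (@is_cvg_pseries_natM _ _ z); rewrite ?(ger0_norm z0).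
  by apply: is_cvg_natZ; rewrite ger0_norm// /z; lra.
by rewrite /z; lra.
Qed.

Lemma Zfun_ge1 phi : 0 <= phi -> phi < `|x0| -> 1 <= Zfun g phi.
Proof.
move=> p0 px.
have cZ : cvgn (pseries (Zcoef g) phi).
  by apply: is_cvg_pseries_inside Zx0 _; exact: inside.
have ndZ : nondecreasing_seq (pseries (Zcoef g) phi).
  apply/nondecreasing_seqP => n.
  rewrite /pseries/series/= big_nat_recr//= lerDl mulr_ge0 ?exprn_ge0//.
  exact: Zcoef_ge0.
apply: le_trans (nondecreasing_cvgn_le ndZ cZ 1%N).
rewrite /pseries/series/= big_nat1 expr0 mulr1 /Zcoef /gfact big_geq//.
by rewrite invr1.
Qed.

Lemma Rfun_continuous phi : 0 <= phi -> phi < `|x0| ->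
  {for phi, continuous (Rfun g)}.
Proof.
move=> p0 px; pose z := (phi + `|x0|) / 2.
have z0 : 0 <= z by rewrite /z; lra.
apply: cvgM.
  apply: cvgV; first by rewrite gt_eqF// (lt_le_trans ltr01)// Zfun_ge1.
  by apply: (@pseries_continuous _ _ x0); rewrite ?inside.
apply: (@pseries_continuous _ _ z).
- by apply: is_cvg_natZ; rewrite ger0_norm// /z; lra.
- by rewrite !ger0_norm// /z; lra.
Qed.

Lemma occupation_mean phi : 0 <= phi -> phi < `|x0| ->
  (\sum_(k <oo) (k%:R * occupation_pmf g phi k)%:E = (Rfun g phi)%:E)%E.
Proof.
move=> p0 px.
pose u k := k%:R * Zcoef g k * phi ^+ k.
have cu : cvgn (series u) by apply: is_cvg_natZ; exact: inside.
transitivity (\sum_(k <oo) (((Zfun g phi)^-1 *: u) k)%:E)%E.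
  apply: eq_eseriesr => k _; congr (_%:E).
  rewrite -[RHS]/((Zfun g phi)^-1 * (k%:R * Zcoef g k * phi ^+ k)).
  by rewrite /occupation_pmf /Zcoef invfM; ring.
rewrite eseries_EFin; last exact: is_cvg_seriesZ.
by rewrite lim_seriesZ.
Qed.

(** Since Z >= 1, dropping the normalisation only increases the moment, and the
    remaining power series has nonnegative coefficients, so it is largest at c.
    The bound is therefore uniform in phi. *)
Lemma occupation_second_moment phi c : 0 <= phi -> phi <= c -> c < `|x0| ->
  (\sum_(k <oo) (k%:R ^+ 2 * occupation_pmf g phi k)%:E <=
    (limn (pseries (fun k => k%:R * (k%:R * Zcoef g k)) c))%:E)%E.
Proof.
move=> p0 pc cx; have c0 := le_trans p0 pc.
rewrite -eseries_EFin; last by apply: is_cvg_natnatZ; exact: inside.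
have Z1 := Zfun_ge1 p0 (le_lt_trans pc cx).
have Z0 : 0 < Zfun g phi := lt_le_trans ltr01 Z1.
have G0 k : 0 <= phi ^+ k / gfact g k.
  by rewrite mulr_ge0 ?exprn_ge0// invr_ge0 ltW// gfact_gt0.
apply: lee_nneseries => k *.
  rewrite lee_fin mulr_ge0 ?sqr_ge0// /occupation_pmf invfM mulrCA.
  by rewrite mulr_ge0// invr_ge0 ltW.
rewrite lee_fin /occupation_pmf /Zcoef invfM /=.
have -> : k%:R * (k%:R / gfact g k) * c ^+ k = k%:R ^+ 2 * (c ^+ k / gfact g k).
  by ring.
rewrite ler_wpM2l ?sqr_ge0//.
apply: (@le_trans _ _ (phi ^+ k / gfact g k)).
  by rewrite mulrCA ler_piMl// invf_le1.
by rewrite ler_wpM2r ?invr_ge0 ?(ltW (gfact_gt0 k))// lerXn2r// nnegrE.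
Qed.

End fugacity.

(** * Riemann sums of continuous functions *)

(** Heine-Cantor: compactness turns the local moduli of continuity into a
    single d, here a point close enough to 0 on the right. *)
Lemma segment_uniform_continuous {R : realType} (f : R -> R) (a b e : R) :
  {within `[a, b], continuous f} -> 0 < e ->
  exists2 d, 0 < d & forall x y, x \in `[a, b] -> y \in `[a, b] ->
    `|x - y| < d -> `|f x - f y| < e.
Proof.
move=> cf e0.
have tri (u v w c : R) : `|u - v| < c / 2 -> `|v - w| < c / 2 -> `|u - w| < c.
  by move=> uv vw; rewrite (le_lt_trans (ler_distD v _ _))//; lra.
pose P (d : R) x := forall y, y \in `[a, b] -> `|x - y| < d -> `|f x - f y| < e.
have /compact_near_coveringP/near_covering_withinP cov := @segment_compact R a b.
have {}cov : \forall d \near (0 : R)^'+, `[a, b]%classic `<=` P d.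
  apply: cov => x xab.
  have e20 : 0 < e / 2 by rewrite divr_gt0.
  have /subspace_continuousP/(_ x xab)/cvgrPdist_lt/(_ _ e20) := cf.
  rewrite near_withinE => /nbhs_ballP[eta /= eta0 feta].
  have eta20 : 0 < eta / 2 by rewrite divr_gt0.
  near=> z d => zab y yab zyd.
  have xz : `|x - z| < eta / 2.
    by near: z; exact: (@nbhsx_ballx _ _ x _ eta20).
  have d2 : d < eta / 2 by near: d; exact: nbhs_right_lt.
  have fz : `|f x - f z| < e / 2 by apply: feta => //; apply: lt_trans xz _; lra.
  have fy : `|f x - f y| < e / 2.
    apply: feta => //; rewrite /ball/=.
    exact: tri xz (lt_trans zyd d2).
  by apply: (tri _ (f x)) fy; rewrite distrC.
near (0 : R)^'+ => d.
exists d => [//|x y xab yab xy].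
have dP : `[a, b]%classic `<=` P d by near: d.
exact: dP.
Unshelve. all: by end_near. Qed.

Section riemann_sums.
Context {R : realType}.
Notation mu := (@lebesgue_measure R).
Variable f : R -> R.
Hypothesis cf : {within `[0, 1], continuous f}.

Let F t := \int[mu]_(u in `[0, t]) f u.

Let intf (A : set R) : measurable A -> A `<=` `[0, 1]%classic ->
  mu.-integrable A (EFin \o f).
Proof.
move=> mA A01; apply: (@integrableS _ _ _ mu `[0, 1]%classic) => //.
by apply: continuous_compact_integrable => //; exact: segment_compact.
Qed.

Lemma right_endpoint_rule (a b e : R) : 0 <= a -> a <= b -> b <= 1 ->
  (forall t, t \in `[a, b] -> `|f t - f b| <= e) ->
  `|F b - F a - f b * (b - a)| <= e * (b - a).
Proof.
move=> a0 ab b1 fe; have b0 := le_trans a0 ab.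
have sub0 : `]a, b] `<=` `[(0 : R), 1]%classic.
  by move=> t /=; rewrite !in_itv/= => /andP[at_ tb]; apply/andP; split; lra.
have Iab : mu.-integrable `]a, b] (EFin \o f) by exact: intf.
have Ic (c : R) : mu.-integrable `]a, b] (EFin \o cst c).
  apply: (@integrableS _ _ _ mu `[a, b]%classic) => //.
    exact: subset_itv_oc_cc.
  by apply: continuous_compact_integrable; [exact: segment_compact|exact: cst_continuous].
have muab : fine (mu `]a, b]%classic) = b - a.
  by rewrite lebesgue_measure_itv/= lte_fin; case: ltP => //= ba; lra.
rewrite /F Rintegral_itvB ?bnd_simp//; last first.
  apply: intf => // t /=; rewrite !in_itv/= => /andP[t0 tb].
  by apply/andP; split; lra.
have -> : f b * (b - a) = \int[mu]_(_ in `]a, b]) f b.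
  by rewrite Rintegral_cst// muab.
rewrite -RintegralB//; last exact: Ic.
have IB : mu.-integrable `]a, b] (EFin \o (fun t => f t - f b)).
  rewrite (_ : _ \o _ = (fun t => (EFin \o f) t - (EFin \o cst (f b)) t)%E)//.
  exact: integrableB.
apply: le_trans (le_normr_Rintegral _ IB) _ => //.
apply: (@le_trans _ _ (\int[mu]_(_ in `]a, b]) e)).
  apply: le_Rintegral => //.
  - exact: integrable_norm IB.
  - exact: Ic.
  - by move=> t tab; apply: fe; exact: subset_itv_oc_cc.
by rewrite Rintegral_cst// muab.
Qed.

(** The integral over [0, 1] telescopes over the cells ]i/N, (i+1)/N], and on
    each of them the error of the right endpoint is at most e/N as soon as 1/N
    is below the modulus of uniform continuity of f. *)
Lemma riemann_sum_cvg :
  N%:R^-1 * \sum_(i < N) f (i.+1%:R / N%:R) @[N --> \oo] --> F 1.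
Proof.
apply/cvgrPdist_le => e e0.
have [d d0 fd] := segment_uniform_continuous cf e0.
near=> N.
have N0 : (0 < N)%N by near: N; exact: nbhs_infty_gt.
have N0R : 0 < N%:R :> R by rewrite ltr0n.
have Nd : N%:R^-1 < d :> R.
  rewrite invf_plt ?posrE//.
  by near: N; exact: nbhs_infty_gtr.
have F0 : F 0 = 0 by rewrite /F set_itv1 Rintegral_set1.
pose x i : R := i%:R / N%:R.
have xS i : x i.+1 - x i = N%:R^-1 by rewrite /x -mulrBl -natrB// subSnn mul1r.
have xN : x N = 1 by rewrite /x divff// gt_eqF.
have x01 i : (i <= N)%N -> 0 <= x i <= 1.
  by move=> iN; rewrite divr_ge0//= ler_pdivrMr// mul1r ler_nat.
have -> : F 1 = \sum_(i < N) (F (x i.+1) - F (x i)).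
  rewrite -(big_mkord xpredT (fun i => F (x i.+1) - F (x i))) telescope_sumr//.
  by rewrite xN /x mul0r F0 subr0.
rewrite mulr_sumr -sumrB.
apply: le_trans (ler_norm_sum _ _ _) _.
apply: (@le_trans _ _ (\sum_(i < N) e * N%:R^-1)); last first.
  by rewrite sumr_const card_ord -[leLHS]mulr_natr mulfVK// gt_eqF.
apply: ler_sum => i _; rewrite [_ * f _]mulrC.
have /andP[xi0 _] := x01 i (ltnW (ltn_ord i)).
have /andP[_ xi1] := x01 i.+1 (ltn_ord i).
have xi : x i <= x i.+1 by rewrite -subr_ge0 xS invr_ge0 ltW.
suff : `|F (x i.+1) - F (x i) - f (x i.+1) * (x i.+1 - x i)| <=
    e * (x i.+1 - x i) by rewrite xS.
apply: right_endpoint_rule => // t txi.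
have txi' := txi; rewrite in_itv/= in txi'; have /andP[t1 t2] := txi'.
apply: ltW; apply: fd; rewrite ?in_itv/=.
- by apply/andP; split; lra.
- by apply/andP; split; lra.
- rewrite ler0_norm; last lra.
  by have := xS i; lra.
Unshelve. all: by end_near. Qed.

End riemann_sums.

(** * The discrete and the limiting fugacity profiles *)

Section profiles.
Context {R : realType}.
Variables (kappa alpha lambda beta delta theta : R).
Hypotheses (theta1 : 1 <= theta) (kappa0 : 0 < kappa) (alpha0 : 0 < alpha)
  (lambda0 : 0 < lambda) (beta0 : 0 < beta) (delta0 : 0 < delta).

Local Notation phiN := (phibarN kappa alpha lambda beta delta theta).
Local Notation phi := (phibar kappa alpha lambda beta delta theta).

Let den (N : nat) : R :=
  kappa * lambda * delta * (N%:R - 2) + (lambda + delta) * N%:R `^ theta.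

Let den_ge N : (2 <= N)%N -> (lambda + delta) * N%:R `^ theta <= den N.
Proof.
move=> N2; have N2R : 2 <= N%:R :> R by rewrite ler_nat.
by rewrite /den lerDr !mulr_ge0 ?subr_ge0// ltW.
Qed.

Let powN_gt0 N : (2 <= N)%N -> 0 < (lambda + delta) * N%:R `^ theta.
Proof.
by move=> N2; rewrite mulr_gt0 ?addr_gt0// powR_gt0// ltr0n (ltn_trans _ N2).
Qed.

Lemma phibarN_gt0 N x : (1 <= x)%N -> (x <= N.-1)%N -> 0 < phiN N x.
Proof.
move=> x1 xN; have N2 : (2 <= N)%N by case: N xN => [|[|N]] //; case: x x1.
apply: divr_gt0; last exact: lt_le_trans (powN_gt0 N2) (den_ge N2).
have x1R : 0 <= x%:R - 1 :> R by rewrite subr_ge0 ler1n.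
have xNR : x%:R + 1 <= N%:R :> R.
  by rewrite natr1 ler_nat; case: N xN N2 {x1R}.
have pN : 0 < (alpha + beta) * N%:R `^ theta.
  by rewrite mulr_gt0 ?addr_gt0// powR_gt0// ltr0n (ltn_trans _ N2).
have -> : - kappa * (alpha * delta - beta * lambda) * (x%:R - 1) +
    kappa * alpha * delta * (N%:R - 2) =
  kappa * alpha * delta * (N%:R - (x%:R + 1)) +
  kappa * beta * lambda * (x%:R - 1) by ring.
apply: ltr_wpDl pN; apply: addr_ge0; apply: mulr_ge0; rewrite ?subr_ge0 ?ler1n//.
- by rewrite !mulr_ge0// ltW.
- by rewrite !mulr_ge0// ltW.
Qed.

Lemma phibar_affine u : phi u = phi 0 + u * (phi 1 - phi 0).
Proof.
rewrite /phibar; case: eqP => _; last by ring.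
field.
by rewrite !gt_eqF ?addr_gt0 ?mulr_gt0.
Qed.

Lemma phibar_ge0 u : 0 <= u <= 1 -> 0 <= phi u.
Proof.
move=> /andP[u0 u1]; rewrite /phibar.
have u1' : 0 <= 1 - u by rewrite subr_ge0.
case: eqP => _; last by rewrite divr_ge0// addr_ge0// ltW.
rewrite divr_ge0//; last by rewrite !addr_ge0// ?mulr_ge0// ltW.
have -> : - kappa * (alpha * delta - beta * lambda) * u +
    kappa * alpha * delta + alpha + beta =
  kappa * alpha * delta * (1 - u) + kappa * beta * lambda * u + alpha + beta.
  by ring.
by rewrite !addr_ge0// ?mulr_ge0// ltW.
Qed.

Let phibarN_sub N x u : (2 <= N)%N ->
  phiN N x - phi u = ((- kappa * (alpha * delta - beta * lambda) * (x%:R - 1)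
   + kappa * alpha * delta * (N%:R - 2) + (alpha + beta) * N%:R `^ theta)
   - phi u * den N) / den N.
Proof.
move=> N2; rewrite mulrBl mulfK// gt_eqF//.
exact: lt_le_trans (powN_gt0 N2) (den_ge N2).
Qed.

Let div_den N (z C : R) : (2 <= N)%N -> `|z| <= C ->
  `|z / den N| <= C / ((lambda + delta) * N%:R `^ theta).
Proof.
move=> N2 zC; have d0 := lt_le_trans (powN_gt0 N2) (den_ge N2).
rewrite normrM normfV [`|den N|]gtr0_norm//.
apply: ler_pM => //; first by rewrite invr_ge0 ltW.
by rewrite lef_pV2 ?posrE ?powN_gt0 ?den_ge.
Qed.

(** Write phibarN - phibar as (numerator - phibar * denominator) / denominator.
    The denominator is at least (lambda + delta) N^theta. For theta = 1 the
    terms of order N cancel in the numerator, which stays bounded; for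
    theta > 1 the terms of order N^theta cancel, the numerator is O(N), and the
    quotient is O(N^(1 - theta)). In both cases the bound does not depend on
    the site. *)
Lemma phibarN_near_phibar (e : R) : 0 < e -> \forall N \near \oo,
  forall x, (1 <= x)%N -> (x <= N.-1)%N -> `|phiN N x - phi (x%:R / N%:R)| <= e.
Proof.
move=> e0; have ld0 : 0 < lambda + delta by rewrite addr_gt0.
have [t1|tn1] := eqVneq theta 1.
- (* C bounds the numerator of the difference. *)
  pose a := kappa * (alpha * delta - beta * lambda).
  pose C := `|a| + 2 * kappa * alpha * delta +
    2 * kappa * lambda * delta * (`|phi 0| + `|phi 1 - phi 0|).
  near=> N; move=> x x1 xN.
  have N2 : (2 <= N)%N by near: N; exact: nbhs_infty_ge.
  have N0 : 0 < N%:R :> R by rewrite ltr0n (ltn_trans _ N2).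
  have NE : N%:R `^ theta = N%:R :> R by rewrite t1 powRr1// ltW.
  set u := x%:R / N%:R.
  have /andP[u0 u1] : 0 <= u <= 1.
    rewrite divr_ge0//= ler_pdivrMr// mul1r ler_nat.
    exact: leq_trans xN (leq_pred _).
  have uN : x%:R = u * N%:R by rewrite mulfVK// gt_eqF.
  rewrite phibarN_sub//; apply: (@le_trans _ _ (C / ((lambda + delta) * N%:R `^ theta))).
    apply: div_den => //.
    have -> : - kappa * (alpha * delta - beta * lambda) * (x%:R - 1)
        + kappa * alpha * delta * (N%:R - 2) + (alpha + beta) * N%:R `^ theta
        - phi u * den N =
      a - 2 * kappa * alpha * delta + 2 * kappa * lambda * delta * phi u.
      rewrite /den NE uN /phibar t1 eqxx /a; field.
      by rewrite !gt_eqF ?addr_gt0 ?mulr_gt0.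
    rewrite /C; apply: le_trans (ler_normD _ _) _; apply: lerD.
      apply: le_trans (ler_normB _ _) _; rewrite lerD2l gtr0_norm//.
      by rewrite !mulr_gt0.
    rewrite normrM gtr0_norm ?mulr_gt0// ler_pM2l ?mulr_gt0//.
    rewrite phibar_affine; apply: le_trans (ler_normD _ _) _; rewrite lerD2l.
    by rewrite normrM ger0_norm// ler_piMl.
  rewrite NE ler_pdivrMr ?mulr_gt0//.
  rewrite mulrA -ler_pdivrMl ?mulr_gt0//.
  by near: N; exact: nbhs_infty_ger.
- (* C N bounds the numerator, and N^(theta - 1) >= K makes the quotient at
     most e. *)
  pose q := (alpha + beta) / (lambda + delta).
  pose C := `|kappa * (alpha * delta - beta * lambda)| +
    `|kappa * alpha * delta - q * (kappa * lambda * delta)|.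
  have th0 : 0 < theta - 1 by rewrite subr_gt0 lt_neqAle eq_sym tn1.
  pose K := C / ((lambda + delta) * e).
  have C0 : 0 <= C by rewrite addr_ge0.
  have K0 : 0 <= K by rewrite divr_ge0// mulr_ge0// ltW.
  near=> N; move=> x x1 xN.
  have N2 : (2 <= N)%N by near: N; exact: nbhs_infty_ge.
  have N0 : 0 < N%:R :> R by rewrite ltr0n (ltn_trans _ N2).
  have NE : N%:R `^ theta = N%:R * N%:R `^ (theta - 1).
    by rewrite -[X in X * _]powRr1 ?ltW// -powRD ?subrKC// [N%:R == 0]gt_eqF// implybT.
  have NK : K <= N%:R `^ (theta - 1).
    have NK' : K `^ (theta - 1)^-1 <= N%:R by near: N; exact: nbhs_infty_ger.
    have := ge0_ler_powR (ltW th0) _ _ NK'.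
    rewrite -powRrM mulVf ?gt_eqF// powRr1//; apply.
    - by rewrite nnegrE powR_ge0.
    - by rewrite nnegrE ltW.
  have phiE u : phi u = q by rewrite /phibar (negbTE tn1).
  rewrite phibarN_sub//.
  apply: (@le_trans _ _ (C * N%:R / ((lambda + delta) * N%:R `^ theta))).
    apply: div_den => //; rewrite phiE.
    have -> : - kappa * (alpha * delta - beta * lambda) * (x%:R - 1)
        + kappa * alpha * delta * (N%:R - 2) + (alpha + beta) * N%:R `^ theta
        - q * den N =
      - (kappa * (alpha * delta - beta * lambda)) * (x%:R - 1) +
      (kappa * alpha * delta - q * (kappa * lambda * delta)) * (N%:R - 2).
      by rewrite /den /q; field; rewrite gt_eqF.
    have xR : 1 <= x%:R :> R by rewrite ler1n.
    have xNR : x%:R <= N%:R :> R.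
      by rewrite ler_nat; exact: leq_trans xN (leq_pred _).
    have NR2 : 2 <= N%:R :> R by rewrite ler_nat.
    rewrite /C; set a1 := kappa * (alpha * delta - beta * lambda).
    set b1 := kappa * alpha * delta - q * (kappa * lambda * delta).
    move: a1 b1 => a1 b1.
    rewrite [leRHS]mulrDl; apply: le_trans (ler_normD _ _) _.
    rewrite !normrM normrN; apply: lerD; rewrite ler_wpM2l//.
    + by rewrite ger0_norm; lra.
    + by rewrite ger0_norm; lra.
  rewrite NE ler_pdivrMr ?mulr_gt0// ?powR_gt0//.
  have -> : e * ((lambda + delta) * (N%:R * N%:R `^ (theta - 1))) =
     (((lambda + delta) * e) * N%:R `^ (theta - 1)) * N%:R by ring.
  by rewrite ler_pM2r// -ler_pdivrMl ?mulr_gt0// mulrC.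
Unshelve. all: by end_near. Qed.

(** As phibar is affine, it is enough to bound it at 0 and at 1, where it is the
    limit of phibarN at the first and at the last site. *)
Lemma phibar_le (c : R) :
  (forall N x, (1 <= x)%N -> (x <= N.-1)%N -> phiN N x <= c) ->
  forall u, 0 <= u <= 1 -> phi u <= c.
Proof.
move=> phic.
have ends (b : bool) : phi b%:R <= c.
  apply/ler_addgt0Pr => e e0.
  have e20 : 0 < e / 2 by rewrite divr_gt0.
  near \oo => N.
  have N2 : (2 <= N)%N by near: N; exact: nbhs_infty_ge.
  have N0 : 0 < N%:R :> R by rewrite ltr0n (ltn_trans _ N2).
  have close : forall x, (1 <= x)%N -> (x <= N.-1)%N ->
    `|phiN N x - phi (x%:R / N%:R)| <= e / 2.
    by near: N; exact: phibarN_near_phibar.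
  pose x := if b then N.-1 else 1%N.
  have [x1 xN] : (1 <= x)%N /\ (x <= N.-1)%N.
    by rewrite /x; case: (b); rewrite leqnn -ltnS prednK// ltnW.
  have xb : `|b%:R - x%:R / N%:R| = N%:R^-1 :> R.
    rewrite /x; case: (b).
      rewrite -[X in X - _](@divff _ N%:R) ?gt_eqF// -mulrBl -natrB ?leq_pred//.
      rewrite -[X in (X - _)%N](prednK (ltnW N2)) subSnn mul1r.
      by rewrite gtr0_norm// invr_gt0.
    by rewrite sub0r normrN mul1r gtr0_norm// invr_gt0.
  have h1 := close x x1 xN.
  have h2 : `|phi b%:R - phi (x%:R / N%:R)| <= e / 2.
    have -> : phi b%:R - phi (x%:R / N%:R) =
        (b%:R - x%:R / N%:R) * (phi 1 - phi 0).
      by rewrite (phibar_affine b%:R) (phibar_affine (x%:R / N%:R)); ring.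
    rewrite normrM xb ler_pdivrMl// -ler_pdivrMr//.
    by near: N; exact: nbhs_infty_ger.
  have := phic _ _ x1 xN.
  move: h1 h2; rewrite !ler_norml => /andP[h1 _] /andP[_ h2].
  by lra.
move=> u /andP[u0 u1]; have /= c0 := ends false; have /= c1 := ends true.
have h0 : 0 <= (1 - u) * (c - phi 0) by rewrite mulr_ge0 ?subr_ge0.
have h1 : 0 <= u * (c - phi 1) by rewrite mulr_ge0 ?subr_ge0.
by rewrite phibar_affine; lra.
Unshelve. all: by end_near. Qed.

Lemma phibar_continuous : continuous phi.
Proof.
pose p0 := phi 0; pose d := phi 1 - phi 0.
have -> : phi = (fun v => p0 + v * d).
  by apply/funext => v; rewrite phibar_affine.
by move=> u; exact: (cvgD (cvg_cst _) (cvgM cvg_id (cvg_cst _))).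
Qed.

End profiles.

(** * Convergence of the mean density *)

Section mean_density.
Context {R : realType} (g : nat -> R).
Hypothesis gpos : forall k, (1 <= k)%N -> 0 < g k.
Variable x0 : R.
Hypothesis Zx0 : cvgn (pseries (Zcoef g) x0).
Variables (kappa alpha lambda beta delta theta : R).
Hypotheses (theta1 : 1 <= theta) (kappa0 : 0 < kappa) (alpha0 : 0 < alpha)
  (lambda0 : 0 < lambda) (beta0 : 0 < beta) (delta0 : 0 < delta).

Local Notation phiN := (phibarN kappa alpha lambda beta delta theta).
Local Notation phi := (phibar kappa alpha lambda beta delta theta).
Local Notation rho := (rhobar kappa alpha lambda beta delta theta g).

Variable c : R.
Hypothesis cx0 : c < `|x0|.
Hypothesis phiNc : forall N x, (1 <= x)%N -> (x <= N.-1)%N -> phiN N x <= c.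

Let phi0c u : 0 <= u <= 1 -> 0 <= phi u <= c.
Proof.
move=> u01; rewrite phibar_ge0//=.
by apply: phibar_le phiNc _ u01.
Qed.

Lemma rhobar_continuous u : 0 <= u <= 1 -> {for u, continuous rho}.
Proof.
move=> /phi0c/andP[p0 pc].
apply: (@continuous_comp _ _ _ phi (Rfun g)); first exact: phibar_continuous.
by apply: (Rfun_continuous gpos Zx0 p0); exact: le_lt_trans cx0.
Qed.

Lemma Rfun_uniform_continuous (e : R) : 0 < e ->
  exists2 d, 0 < d & forall x y, 0 <= x <= c -> 0 <= y <= c ->
    `|x - y| < d -> `|Rfun g x - Rfun g y| < e.
Proof.
move=> e0.
have cR : {within `[0, c], continuous (Rfun g)}.
  apply/subspace_continuousP => x /=; rewrite in_itv/= => /andP[x_0 xc].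
  apply: cvg_within_filter.
  by apply: (Rfun_continuous gpos Zx0 x_0); exact: le_lt_trans cx0.
have [d d0 dP] := segment_uniform_continuous cR e0.
by exists d => // x y xc yc; apply: dP; rewrite in_itv.
Qed.

Variables (H : R -> R) (B : R).
Hypothesis cH : {within `[0, 1], continuous H}.
Hypothesis HB : forall u, 0 <= u <= 1 -> `|H u| <= B.

Lemma test_profile_continuous : {within `[0, 1], continuous (fun u => H u * rho u)}.
Proof.
apply/subspace_continuousP => x x01; apply: cvgM.
  by move/subspace_continuousP : cH; apply.
apply: cvg_within_filter; apply: rhobar_continuous.
by move: x01; rewrite /= in_itv.
Qed.

(** Three errors of size e/3: replacing phibarN by phibar at the sites (uniform
    continuity of Rfun on [0, c]), adding the missing endpoint 1 to the sum, and
    replacing the Riemann sum by the integral. *)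
Lemma mean_density_near (e : R) : 0 < e -> \forall N \near \oo,
  `|N%:R^-1 * \sum_(i < N.-1) H (i.+1%:R / N%:R) * Rfun g (phiN N i.+1)
    - \int[lebesgue_measure]_(u in `[0, 1]) (H u * rho u)| <= e.
Proof.
move=> e0.
have B0 : 0 <= B by apply: le_trans (HB (u := 0) _); rewrite ?lexx ?ler01.
pose f u := H u * rho u.
have e30 : 0 < e / 3 by rewrite divr_gt0.
(* B may vanish, hence the divisor B + 1. *)
have B10 : 0 < B + 1 by rewrite ltr_wpDl.
have [d d0 Rd] := @Rfun_uniform_continuous (e / 3 / (B + 1)) (divr_gt0 e30 B10).
have d20 : 0 < d / 2 by rewrite divr_gt0.
near=> N.
have N2 : (2 <= N)%N by near: N; exact: nbhs_infty_ge.
have N0 : 0 < N%:R :> R by rewrite ltr0n (ltn_trans _ N2).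
have step1 : `|N%:R^-1 * \sum_(i < N) f (i.+1%:R / N%:R) -
    \int[lebesgue_measure]_(u in `[0, 1]) f u| <= e / 3.
  rewrite distrC.
  by near: N; move/cvgrPdist_le : (riemann_sum_cvg test_profile_continuous) => /(_ _ e30).
have close : forall x, (1 <= x)%N -> (x <= N.-1)%N ->
    `|phiN N x - phi (x%:R / N%:R)| <= d / 2.
  by near: N; apply: phibarN_near_phibar.
have step2 : `|N%:R^-1 * f 1| <= e / 3.
  rewrite normrM normfV normr_nat ler_pdivrMl// -ler_pdivrMr//.
  by near: N; exact: nbhs_infty_ger.
have NE : N = N.-1.+1 by rewrite prednK// ltnW.
have sumN : \sum_(i < N) f (i.+1%:R / N%:R) =
    \sum_(i < N.-1) f (i.+1%:R / N%:R) + f 1.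
  rewrite -(big_mkord xpredT (fun i => f (i.+1%:R / N%:R))) [X in \sum_(0 <= _ < X) _]NE.
  rewrite big_nat_recr//= -NE divff ?gt_eqF//; congr (_ + _).
  by rewrite big_mkord.
have step3 : `|N%:R^-1 * \sum_(i < N.-1) H (i.+1%:R / N%:R) * Rfun g (phiN N i.+1)
     - N%:R^-1 * \sum_(i < N.-1) f (i.+1%:R / N%:R)| <= e / 3.
  rewrite -mulrBr -sumrB normrM gtr0_norm ?invr_gt0// ler_pdivrMl//.
  apply: le_trans (ler_norm_sum _ _ _) _.
  apply: (@le_trans _ _ (\sum_(i < N.-1) (e / 3))); last first.
    rewrite sumr_const card_ord -[leLHS]mulr_natl ler_pM2r//.
    by rewrite ler_nat leq_pred.
  apply: ler_sum => i _; rewrite /f -mulrBr normrM.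
  have iN : (i.+1 <= N.-1)%N := ltn_ord i.
  pose u : R := i.+1%:R / N%:R.
  have u01 : 0 <= u <= 1.
    rewrite /u divr_ge0//= ler_pdivrMr// mul1r ler_nat.
    exact: leq_trans iN (leq_pred _).
  have Ri : `|Rfun g (phiN N i.+1) - rho (i.+1%:R / N%:R)| <= e / 3 / (B + 1).
    apply/ltW/Rd.
    - by rewrite phiNc// andbT ltW// phibarN_gt0.
    - exact: phi0c.
    - by apply: le_lt_trans (close _ _ iN) _ => //; lra.
  apply: (@le_trans _ _ ((B + 1) * (e / 3 / (B + 1)))).
    by apply: ler_pM => //; apply: le_trans (HB u01) _; lra.
  by rewrite mulrCA divff ?mulr1// gt_eqF.
rewrite sumN mulrDr in step1.
move: step1 step2 step3; set I := \int[_]_(_ in _) _.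
set S := N%:R^-1 * \sum_(i < N.-1) f _.
set W := N%:R^-1 * \sum_(i < N.-1) _ * _; set w := N%:R^-1 * f 1.
move: I S W w => I S W w h1 h2 h3.
have -> : W - I = (W - S) + (S + w - I) - w by ring.
apply: le_trans (ler_normB _ _) _; apply: le_trans (lerD (ler_normD _ _) h2) _.
by lra.
Unshelve. all: by end_near. Qed.

End mean_density.

(** * A weak law for product measures *)

Lemma ge0_integral_comp_nat d (T : measurableType d) (R : realType)
    (P : probability T R) (U : T -> nat) (f : nat -> R) :
  measurable_fun setT U -> (forall k, 0 <= f k) ->
  (\int[P]_w (f (U w))%:E = \sum_(k <oo) (f k)%:E * P (U @^-1` [set k]))%E.
Proof.
move=> mU f0.
have UT : \bigcup_k (U @^-1` [set k]) = setT.
  by rewrite -subTset => w _; exists (U w).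
have mpre k : measurable (U @^-1` [set k]).
  by rewrite -[X in measurable X]setTI; exact: mU.
rewrite -[X in integral _ X]UT ge0_integral_bigcup//.
- apply: eq_eseriesr => k _.
  rewrite (eq_integral (cst (f k)%:E)); last by move=> w; rewrite inE => /= ->.
  by rewrite integral_cst.
- rewrite UT; apply/measurable_EFinP.
  exact: (measurableT_comp (f := f) (g := U)).
- by move=> w _; rewrite lee_fin.
- by move=> i j _ _ [w [/= <- <-]].
Qed.

(** The hypothesis says that the joint law of U and V agrees with the product of
    their laws on rectangles, hence everywhere; Tonelli then factors the
    integral. *)
Lemma indep_integralM d (T : measurableType d) (R : realType)
    (P : probability T R) (U V : {mfun T >-> nat}) (f h : nat -> R) :
  (forall k, 0 <= f k) -> (forall k, 0 <= h k) ->
  (forall A B : set nat, P (U @^-1` A `&` V @^-1` B) =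
      P (U @^-1` A) * P (V @^-1` B))%E ->
  (\int[P]_w (f (U w) * h (V w))%:E =
   \int[P]_w (f (U w))%:E * \int[P]_w (h (V w))%:E)%E.
Proof.
move=> f0 h0 UV.
pose W w := (U w, V w).
have mW : measurable_fun setT W by exact: measurable_fun_pair.
pose W' : {mfun T >-> (nat * nat)%type} := mfun_Sub (mem_set mW : W \in mfun).
pose PU := distribution P U; pose PV := distribution P V.
pose PW := distribution P W'.
have PWE : forall X, measurable X -> (PU \x PV)%E X = PW X.
  by apply: product_measure_unique => A B _ _; rewrite -UV.
have mf : measurable_fun setT (fun z : nat * nat => (f z.1 * h z.2)%:E).
  apply/measurable_EFinP; apply: measurable_funM.
  - exact: (measurableT_comp (f := f)).
  - exact: (measurableT_comp (f := h)).
have fh0 z : (0 <= (f z.1 * h z.2)%:E)%E by rewrite lee_fin mulr_ge0.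
transitivity (\int[PW]_z (f z.1 * h z.2)%:E)%E.
  rewrite ge0_integral_distribution//=.
rewrite (eq_measure_integral (PU \x PV)%E); last first.
  by move=> A mA _; exact/esym/PWE.
rewrite fubini_tonelli1// /fubini_F/=.
have mf1 : measurable_fun [set: nat] (EFin \o f) by [].
have mh1 : measurable_fun [set: nat] (EFin \o h) by [].
under eq_integral => x _.
  under eq_integral => y _ do rewrite EFinM.
  rewrite ge0_integralZl ?lee_fin//=; last by move=> y _; rewrite lee_fin.
  over.
rewrite ge0_integralZr//=; last 2 first.
- by move=> y _; rewrite lee_fin.
- by apply: integral_ge0 => y _; rewrite lee_fin.
congr (_ * _)%E; rewrite ge0_integral_distribution//.
Qed.

Lemma Lfun2_Lfun1 d (T : measurableType d) (R : realType)
    (P : probability T R) (X : T -> R) : X \in Lfun P 2%:E -> X \in Lfun P 1.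
Proof.
have Pfin : P setT \is a fin_num := fin_num_measure P _ measurableT.
exact: Lfun_subset12 Pfin _.
Qed.

Section uncorrelated.
Local Open Scope ereal_scope.
Context d (T : measurableType d) (R : realType) (P : probability T R).
Variables (I : eqType) (X : I -> T -> R).
Hypothesis X2 : forall i, X i \in Lfun P 2%:E.

Lemma Lfun2_sum (s : seq I) : (\sum_(i <- s) X i)%R \in Lfun P 2%:E.
Proof. by apply: rpred_sum => *; rewrite ?lee1n. Qed.

Lemma expectation_sumE (s : seq I) :
  'E_P[\sum_(i <- s) X i]%R = \sum_(i <- s) 'E_P[X i].
Proof.
have := @expectation_sum _ _ _ P (map X s); rewrite !big_map; apply.
by move=> _ /mapP[i _ ->]; exact: Lfun2_Lfun1.
Qed.

Lemma covariance_sumr (Y : T -> R) (s : seq I) : Y \in Lfun P 2%:E ->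
  covariance P Y (\sum_(i <- s) X i)%R = \sum_(i <- s) covariance P Y (X i).
Proof.
move=> Y2; elim: s => [|i s IH]; first by rewrite !big_nil covariance_cst_r.
by rewrite !big_cons -IH covarianceDr// Lfun2_sum.
Qed.

Lemma variance_sum (s : seq I) : uniq s ->
  {in s &, forall i j, i != j -> covariance P (X i) (X j) = 0} ->
  'V_P[\sum_(i <- s) X i]%R = \sum_(i <- s) 'V_P[X i].
Proof.
elim: s => [|i s IH]; first by rewrite !big_nil variance_cst.
move=> /= /andP[iNs us] cov0.
rewrite !big_cons varianceD ?Lfun2_sum// -IH//; last first.
  by move=> j k js ks; apply: cov0; rewrite inE ?js ?ks orbT.
rewrite covariance_sumr//.
rewrite [X in 2%:E * X]big_seq [X in 2%:E * X]big1 ?mule0 ?adde0// => j js.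
apply: cov0; rewrite ?inE ?eqxx ?js ?orbT//.
by apply: contraNneq iNs => ->.
Qed.

End uncorrelated.

(** The expectation of U V factors; the finite second moments make the
    difference with the product of the expectations meaningful. *)
Lemma covariance_indep d (T : measurableType d) (R : realType)
    (P : probability T R) (U V : {mfun T >-> nat}) :
  (forall A B : set nat, P (U @^-1` A `&` V @^-1` B) =
      P (U @^-1` A) * P (V @^-1` B))%E ->
  (fun w => (U w)%:R : R) \in Lfun P 2%:E ->
  (fun w => (V w)%:R : R) \in Lfun P 2%:E ->
  covariance P (fun w => (U w)%:R) (fun w => (V w)%:R) = 0%E.
Proof.
move=> UV U2 V2.
have U1 := Lfun2_Lfun1 U2; have V1 := Lfun2_Lfun1 V2.
rewrite covarianceE ?Lfun2_mul_Lfun1// unlock.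
rewrite (indep_integralM (f := fun k => k%:R) (h := fun k => k%:R) _ _ UV)//.
rewrite subee// fin_numM//.
- by have := expectation_fin_num U1; rewrite unlock.
- by have := expectation_fin_num V1; rewrite unlock.
Qed.

(** The product rule for the family of sets equal to A at i, to B at j and to
    the whole of nat at every other site, where the factor is 1. *)
Lemma product_measure_pair (R : realType) N (P : probability (config N) R) :
  is_product_measure P -> forall i j : 'I_N.-1, i != j ->
  forall A B : set nat,
  (P ((fun eta => tnth eta i) @^-1` A `&` (fun eta => tnth eta j) @^-1` B) =
   P ((fun eta => tnth eta i) @^-1` A) *
   P ((fun eta => tnth eta j) @^-1` B))%E.
Proof.
move=> prodP i j ij A B.
pose C k := if k == i then A else if k == j then B else setT.
have -> : (fun eta : config N => tnth eta i) @^-1` A `&`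
    (fun eta => tnth eta j) @^-1` B = [set eta | forall k, C k (tnth eta k)].
  apply/seteqP; split => [eta [/= Ai Bj] k|eta Ceta].
    by rewrite /C; have [->//|_] := eqVneq k i; have [->//|_] := eqVneq k j.
  split; first by have := Ceta i; rewrite /C eqxx.
  by have := Ceta j; rewrite /C eqxx eq_sym (negbTE ij).
rewrite prodP (bigD1 i)//= (bigD1 j) ?(eq_sym j)//= {1 2}/C !eqxx.
rewrite eq_sym (negbTE ij) big1 ?mule1// => k /andP[ki kj].
rewrite /C (negbTE ki) (negbTE kj).
by rewrite [X in P X](_ : _ = setT) ?probability_setT//; apply/seteqP.
Qed.

Lemma Lfun2_sqr_integral d (T : measurableType d) (R : realType)
    (P : probability T R) (X : T -> R) : measurable_fun setT X ->
  (\int[P]_w (X w ^+ 2)%:E < +oo)%E -> X \in Lfun P 2%:E.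
Proof.
move=> mX intX; rewrite inE; apply/andP; split; first by rewrite inE.
rewrite inE/= /finite_norm unlock /= poweR_lty//.
under eq_integral => x _.
  rewrite /= -[2%R]/(2%:R) powR_mulrn// -normrX ger0_norm ?sqr_ge0//.
  over.
exact: intX.
Qed.

Section weak_law.
Context (R : realType) (N : nat) (P : probability (config N) R).
Variables (p : 'I_N.-1 -> nat -> R) (m a : 'I_N.-1 -> R) (B M : R).
Hypothesis prodP : is_product_measure P.
Hypothesis margP : forall i k, P [set eta | tnth eta i = k] = (p i k)%:E.
Hypothesis meanP : forall i, (\sum_(k <oo) (k%:R * p i k)%:E = (m i)%:E)%E.
Hypothesis momP : forall i, (\sum_(k <oo) (k%:R ^+ 2 * p i k)%:E <= M%:E)%E.
Hypothesis aB : forall i, `|a i| <= B.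

Let X (i : 'I_N.-1) (eta : config N) : R := (tnth eta i)%:R.

Let mtnth (i : 'I_N.-1) : measurable_fun setT (fun eta : config N => tnth eta i).
Proof. exact: measurable_tnth. Qed.

Let mX i : measurable_fun setT (X i).
Proof.
exact: (measurableT_comp (f := fun k : nat => k%:R : R)
          (g := fun eta : config N => tnth eta i)).
Qed.

Let sqrX i : (\int[P]_eta (X i eta ^+ 2)%:E <= M%:E)%E.
Proof.
rewrite (ge0_integral_comp_nat P (f := fun k => k%:R ^+ 2) (mtnth i))//.
under eq_eseriesr => k _ do rewrite margP -EFinM.
exact: momP.
Qed.

Let X2 i : X i \in Lfun P 2%:E.
Proof.
apply: Lfun2_sqr_integral => //.
exact: le_lt_trans (sqrX i) (ltry _).
Qed.

Let EX i : 'E_P[X i]%E = (m i)%:E.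
Proof.
rewrite unlock (ge0_integral_comp_nat P (f := fun k => k%:R) (mtnth i))//.
by under eq_eseriesr => k _ do rewrite margP -EFinM.
Qed.

Let VX i : ('V_P[X i] <= M%:E)%E.
Proof.
rewrite varianceE//; apply: le_trans (sqrX i).
rewrite EX unlock -EFin_expe leeBlDr// leeDl//.
by rewrite lee_fin sqr_ge0.
Qed.

Let covX i j : i != j -> covariance P (X i) (X j) = 0%E.
Proof.
move=> ij.
apply: (covariance_indep (U := mfun_Sub (mem_set (mtnth i)))
                         (V := mfun_Sub (mem_set (mtnth j)))).
- exact: product_measure_pair.
- exact: X2 i.
- exact: X2 j.
Qed.

Let Y i := a i \o* X i.

Let Y2 i : Y i \in Lfun P 2%:E.
Proof. by apply: Lfun_scale => //; rewrite ler1n. Qed.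

Let covY i j : i != j -> covariance P (Y i) (Y j) = 0%E.
Proof.
move=> ij.
have L1 k := Lfun2_Lfun1 (X2 k); have Y1 := Lfun2_Lfun1 (Y2 j).
rewrite covarianceZl// ?Lfun2_mul_Lfun1//.
by rewrite covarianceZr// ?Lfun2_mul_Lfun1// covX// !mule0.
Qed.

(** Chebyshev's inequality for the weighted sum of the coordinates. Distinct
    coordinates are uncorrelated, so the variance is the sum of N - 1 terms,
    each at most B^2 M because a variance is at most the second moment. *)
Lemma product_measure_weak_law (r : R) : 0 < r ->
  (P [set eta | (r <= `|(\sum_i a i * (tnth eta i)%:R) - \sum_i a i * m i|)%R]
   <= (r ^- 2 * (N.-1%:R * (B ^+ 2 * M)))%:E)%E.
Proof.
move=> r0.
pose S := (\sum_(i <- index_enum 'I_N.-1) Y i)%R.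
have S2 : S \in Lfun P 2%:E by exact: Lfun2_sum.
have mS : S \in mfun by move: S2; rewrite inE => /andP[].
pose S' : {mfun config N >-> R} := mfun_Sub mS.
have SE eta : S' eta = \sum_i a i * (tnth eta i)%:R.
  rewrite /= /S fct_sumE; apply: eq_bigr => i _.
  by rewrite /Y/= mulrC.
have ES : ('E_P[S'] = (\sum_i a i * m i)%:E)%E.
  rewrite [X in 'E_P[X]%E](_ : _ = S)// expectation_sumE// -sumEFin.
  apply: eq_bigr => i _; rewrite expectationZl ?EX//.
  exact: Lfun2_Lfun1.
have := @chebyshev _ _ _ P S' _ r0; rewrite ES /=.
rewrite (_ : [set _ | _] = [set eta | r <= `|(\sum_i a i * (tnth eta i)%:R) - \sum_i a i * m i|]); last first.
  by apply: eq_set => eta; rewrite -SE.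
move=> /le_trans; apply.
rewrite EFinM lee_pmul2l ?lte_fin ?invr_gt0 ?exprn_gt0//.
rewrite /S variance_sum//; last first.
- by move=> i j _ _; exact: covY.
- exact: index_enum_uniq.
have -> : ((N.-1%:R * (B ^+ 2 * M))%:E = \sum_(i < N.-1) (B ^+ 2 * M)%:E)%E.
  by rewrite sumEFin sumr_const card_ord mulr_natl.
apply: lee_sum => i _; rewrite varianceZ// [leRHS]EFinM.
apply: lee_pmul => //; first by rewrite lee_fin sqr_ge0.
- exact: variance_ge0.
- by rewrite lee_fin -real_normK ?num_real// lerXn2r// nnegrE (le_trans _ (aB i)).
Qed.

End weak_law.

Lemma weighted_sum_measurable {R : realType} N (a : 'I_N.-1 -> R) :
  measurable_fun [set: config N] (fun eta => \sum_i a i * (tnth eta i)%:R).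
Proof.
apply: measurable_sum => i; apply: measurable_funM => //.
exact: (measurableT_comp (f := fun k : nat => k%:R : R)
          (g := fun eta : config N => tnth eta i) _ (measurable_tnth i)).
Qed.

Lemma deviation_measurable d (T : measurableType d) {R : realType}
    (h : T -> R) (l : R) (J : interval R) : measurable_fun setT h ->
  measurable [set w | `|h w - l| \in J].
Proof.
move=> mh; have mhl : measurable_fun setT (fun w => `|h w - l|).
  by apply: measurableT_comp => //; exact: measurable_funB.
by rewrite -[X in measurable X]setTI; exact: mhl (measurable_itv J).
Qed.

(** * The hydrostatic limit *)

(** The strict inequality between the supremum and phistar leaves room for a
    convergence point x0 of Z beyond all the fugacities; c is the supremum
    itself. *)
Lemma subcritical_bound {R : realType} (g : nat -> R)
    (kappa alpha lambda beta delta theta : R) :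
  1 <= theta -> 0 < kappa -> 0 < alpha -> 0 < lambda -> 0 < beta -> 0 < delta ->
  (ereal_sup
      [set y | exists N x : nat, [/\ (1 <= x)%N, (x <= N.-1)%N &
         y = (phibarN kappa alpha lambda beta delta theta N x)%:E]]
    < phistar g)%E ->
  exists c x0 : R, [/\ 0 <= c, c < `|x0|, cvgn (pseries (Zcoef g) x0) &
    forall N x, (1 <= x)%N -> (x <= N.-1)%N ->
      phibarN kappa alpha lambda beta delta theta N x <= c].
Proof.
move=> theta1 kappa0 alpha0 lambda0 beta0 delta0.
set S := (X in ereal_sup X) => /ereal_sup_gt[_ [x0 cx0 <-] Sx0].
have leS N x : (1 <= x)%N -> (x <= N.-1)%N ->
    ((phibarN kappa alpha lambda beta delta theta N x)%:E <= ereal_sup S)%E.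
  by move=> x1 xN; apply: ereal_sup_ubound; exists N, x.
have Sfin : ereal_sup S \is a fin_num.
  rewrite fin_numElt (lt_trans Sx0 (ltry _)) andbT.
  exact: lt_le_trans (ltNyr _) (leS 2%N 1%N isT isT).
have leSf N x : (1 <= x)%N -> (x <= N.-1)%N ->
    phibarN kappa alpha lambda beta delta theta N x <= fine (ereal_sup S).
  by move=> x1 xN; rewrite -lee_fin fineK// leS.
exists (fine (ereal_sup S)), x0; split => //.
- by apply: le_trans (leSf 2%N 1%N isT isT); rewrite ltW// phibarN_gt0.
- by rewrite -lte_fin fineK.
Qed.

Theorem mainTheorem2 (R : realType) (g : nat -> R)
  (g0 : g 0%N = 0)
  (gpos : forall k, (1 <= k)%N -> 0 < g k)
  (glip : has_ubound [set `|g k.+1 - g k| | k in [set k | (1 <= k)%N]])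
  (gmono : {homo g : m n / (m <= n)%N >-> m <= n})
  (Zdiv : Z_diverges g)
  (theta kappa alpha lambda beta delta : R)
  (theta1 : 1 <= theta) (kappa0 : 0 < kappa)
  (alpha0 : 0 < alpha) (lambda0 : 0 < lambda)
  (beta0 : 0 < beta) (delta0 : 0 < delta)
  (phisup : (ereal_sup
      [set y | exists N x : nat, [/\ (1 <= x)%N, (x <= N.-1)%N &
         y = (phibarN kappa alpha lambda beta delta theta N x)%:E]]
    < phistar g)%E)
  (nubar : forall N, probability (config N) R)
  (nubar_prod : forall N, (2 <= N)%N -> is_product_measure (nubar N))
  (nubar_marg : forall N, (2 <= N)%N ->
    has_marginals (nubar N) (fun x =>
      occupation_pmf g (phibarN kappa alpha lambda beta delta theta N x))) :
  associated_to_profile nubar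
    (rhobar kappa alpha lambda beta delta theta g).
Proof.
have [c [x0 [c0 cx0 Zx0 phiNc]]] :=
  subcritical_bound theta1 kappa0 alpha0 lambda0 beta0 delta0 phisup.
move=> r r0 H cH.
have [B HB] : exists B : R, forall u : R, 0 <= u <= 1 -> `|H u| <= B.
  have cnH : {within `[0, 1], continuous (fun u => `|H u|)}.
    apply/subspace_continuousP => u u01; apply: cvg_norm.
    by move/subspace_continuousP : cH; apply.
  have [v _ vmax] := EVT_max ler01 cnH.
  by exists `|H v| => u u01; apply: vmax; rewrite in_itv.
have B0 : 0 <= B by apply: le_trans (HB 0 _); rewrite ?lexx ?ler01.
set I := \int[lebesgue_measure]_(u in `[0, 1]) _.
pose K : R := limn (pseries (fun k => k%:R * (k%:R * Zcoef g k)) c).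
have K0 : 0 <= K.
  have := occupation_second_moment gpos Zx0 c0 (lexx c) cx0.
  rewrite -/K -lee_fin; apply: le_trans; apply: nneseries_ge0 => k *.
  rewrite lee_fin mulr_ge0 ?sqr_ge0// /occupation_pmf divr_ge0 ?exprn_ge0//.
  have Z0 : 0 <= Zfun g c by rewrite (le_trans ler01)// (Zfun_ge1 gpos Zx0).
  by rewrite mulr_ge0// ltW// gfact_gt0.
have r20 : 0 < r / 2 by rewrite divr_gt0.
(* K bounds the second moments, and Chebyshev's inequality at distance N r / 2
   gives (N r / 2)^-2 N B^2 K = C / N. *)
pose C := (r / 2) ^- 2 * (B ^+ 2 * K).
suff bnd : \forall N \near \oo,
    (nubar N [set eta | r < `|empirical H eta - I| ]%R <= (C * N%:R^-1)%:E)%E.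
  apply: (@squeeze_cvge _ _ _ _ (cst 0%E) _ (fun N => (C * N%:R^-1)%:E)).
  - near=> N; rewrite measure_ge0/=; near: N; exact: bnd.
  - exact: cvg_cst.
  - apply: cvg_EFin; first by near=> N.
    rewrite -[X in _ --> X](mulr0 C); apply: cvgM; first exact: cvg_cst.
    rewrite -(cvg_shiftS (fun N : nat => N%:R^-1 : R)); exact: cvg_harmonic.
near=> N.
have N2 : (2 <= N)%N by near: N; exact: nbhs_infty_ge.
have N0 : 0 < N%:R :> R by rewrite ltr0n (ltn_trans _ N2).
have mean : `|N%:R^-1 * (\sum_(i < N.-1) H (i.+1%:R / N%:R) *
     Rfun g (phibarN kappa alpha lambda beta delta theta N i.+1)) - I| <= r / 2.
  by near: N; apply: (mean_density_near gpos Zx0 _ _ _ _ _ _ cx0 phiNc cH HB).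
pose phiN i := phibarN kappa alpha lambda beta delta theta N i.
pose m (i : 'I_N.-1) := Rfun g (phiN i.+1).
pose a (i : 'I_N.-1) : R := H (i.+1%:R / N%:R).
have phiN0 (i : 'I_N.-1) : 0 <= phiN i.+1 by rewrite ltW// phibarN_gt0.
have phiNx (i : 'I_N.-1) : phiN i.+1 < `|x0|.
  exact: le_lt_trans (phiNc N i.+1 isT (ltn_ord i)) cx0.
have aB (i : 'I_N.-1) : `|a i| <= B.
  pose u : R := i.+1%:R / N%:R; have u01 : 0 <= u <= 1.
    rewrite /u divr_ge0//= ler_pdivrMr// mul1r ler_nat.
    exact: leq_trans (ltn_ord i) (leq_pred _).
  exact: HB u01.
have := @product_measure_weak_law _ N (nubar N)
  (fun i => occupation_pmf g (phiN i.+1)) m a B K (nubar_prod _ N2)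
  (nubar_marg _ N2) (fun i => occupation_mean Zx0 (phiN0 i) (phiNx i))
  (fun i => occupation_second_moment gpos Zx0 (phiN0 i) (phiNc N i.+1 isT (ltn_ord i)) cx0)
  aB (N%:R * (r / 2)) (mulr_gt0 N0 r20).
move=> wl; apply: le_trans (le_trans wl _).
- apply: le_measure; rewrite ?inE.
  + have := @deviation_measurable _ (config N) _ (empirical H) I `]r, +oo[.
    under eq_set do rewrite in_itv/= andbT.
    by apply; apply: measurable_funM => //; exact: weighted_sum_measurable.
  + have := @deviation_measurable _ (config N) _ _ (\sum_i a i * m i)
      `[N%:R * (r / 2), +oo[ (weighted_sum_measurable a).
    by under eq_set do rewrite in_itv/= andbT.
  (* A deviation by r from the limit is one by r / 2 from the mean. *)
  move=> eta /= reta.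
  set SX := \sum_i _; set Sm := \sum_i _.
  have hX : empirical H eta = N%:R^-1 * SX by [].
  have hm : `|N%:R^-1 * Sm - I| <= r / 2 := mean.
  rewrite -ler_pdivlMl// -[N%:R^-1]gtr0_norm ?invr_gt0// -normrM mulrBr -hX.
  have := ler_distD (N%:R^-1 * Sm) (empirical H eta) I.
  by lra.
- rewrite lee_fin /C exprMn invfM.
  have N10 : N.-1%:R <= N%:R :> R by rewrite ler_nat leq_pred.
  have D0 : 0 <= (r / 2) ^- 2 * (B ^+ 2 * K).
    by rewrite !mulr_ge0 ?sqr_ge0// invr_ge0 sqr_ge0.
  have -> : N%:R ^- 2 * (r / 2) ^- 2 * (N.-1%:R * (B ^+ 2 * K)) =
    (r / 2) ^- 2 * (B ^+ 2 * K) * (N%:R ^- 2 * N.-1%:R) by ring.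
  rewrite ler_wpM2l// expr2 invfM -mulrA ler_piMr ?invr_ge0 ?ler0n//.
  by rewrite ler_pdivrMl// mulr1.
Unshelve. all: by end_near. Qed.
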